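(* Let $p$ be a Wolstenholme prime. Then $$\binom{2p-1}{p-1} \equiv 1 + \frac{3p}{2}\sum_{k=1}^{p-1}\frac{1}{k} - \frac{p^2}{4}\sum_{k=1}^{p-1}\frac{1}{k^2} + \frac{7p^3}{12}\sum_{k=1}^{p-1}\frac{1}{k^3} + \frac{5p^5}{12}\sum_{k=1}^{p-1}\frac{1}{k^5} \pmod{p^8}.$$
   Context: A prime $p$ is called a Wolstenholme prime if $\binom{2p-1}{p-1}\equiv 1 \pmod{p^4}$. Congruences between rational numbers modulo $p^e$ are understood in the ring of rationals with denominator prime to $p$: $a\equiv b \pmod{p^e}$ means that $a-b$, written in reduced form, has numerator divisible by $p^e$ and denominator prime to $p$. *)

(* Defs.v *)
From mathcomp Require Import all_boot all_order all_algebra.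

Set Implicit Arguments.
Unset Strict Implicit.
Unset Printing Implicit Defensive.

Import GRing.Theory.
Local Open Scope ring_scope.

Definition wolstenholme_prime (p : nat) : Prop :=
  prime p /\ ('C(2 * p - 1, p - 1) = 1 %[mod p ^ 4])%N.

(* [numq] and [denq] give the reduced form, with [denq] positive. *)
Definition rat_eqmod (p e : nat) (a b : rat) : Prop :=
  ((p ^ e)%N%:Z %| numq (a - b))%Z /\ coprimez p%:Z (denq (a - b)).

Definition inv_power_sum (p m : nat) : rat :=
  \sum_(1 <= k < p) 1 / k%:R ^+ m.

(* Main.v *)
Require Import Defs.
From mathcomp Require Import all_boot all_order all_algebra.
From HB Require Import structures.
From mathcomp Require Import ring.

Import GRing.Theory Num.Theory.
Local Open Scope ring_scope.

(** The factors of the binomial coefficient C = prod_k (1 + p/k) are paired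
    by the reflection k <-> p - k.  With u_k = 1 / (k (p - k)) one has
    (1 + p/k) (1 + p/(p-k)) = 1 + 2 p^2 u_k, so the square of C is a product
    of factors 1 + X (2 u_k) with X = p^2, and modulo p^8 = X^4 only its
    elementary symmetric functions of degree at most 3 matter
    ([prod_1DX_trunc]).  Write U_m for the sum of the u_k^m.  Since p is a
    Wolstenholme prime, C = 1 + X^2 c with c an integer, which forces X to
    divide U_1; hence X^2 U_1^2, X^3 U_1 U_2 and X^3 U_1^3 vanish modulo X^4,
    and C = 1 + X U_1 - X^2 U_2 + 4/3 X^3 U_3 modulo p^8
    ([square_expansion_linearize]).

    The sums of inverse powers H_m on the right-hand side are expressed exactly
    by the U_m, because 1/k and 1/(p-k) have sum p u_k and product u_k
    ([reflected_power_sum]).  After this substitution the right-hand side is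
    the same polynomial in the U_m, up to 5/24 X^4 (X U_5 - 5 U_4).  The
    denominators have only the prime factors 2 and 3, which are units
    modulo p because p > 3. *)

(** * The rationals with denominator prime to p *)

Definition plocal (p : nat) : {pred rat} := fun x => coprimez p (denq x).

(** Reduced fractions do not add or multiply to reduced fractions; allowing any
    denominator prime to p makes closure under the ring operations immediate. *)
Lemma plocalP (p : nat) (x : rat) :
  reflect (exists2 d : int, coprimez p d & exists n : int, x * d%:~R = n%:~R)
          (x \in plocal p).
Proof.
apply: (iffP idP) => [px | [d pd [n xdn]]].
  exists (denq x) => //; exists (numq x); rewrite numqE //.
have E : numq x * d = n * denq x.
  by apply: (@intr_inj rat); rewrite !intrM -xdn numqE mulrAC.
have cop : coprimez (denq x) (numq x).
  by rewrite coprimez_sym /coprimez /gcdz; exact: coprime_num_den.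
have dvd : (denq x %| d)%Z by rewrite -(Gauss_dvdzr d cop) E dvdz_mull.
by move: pd; rewrite unfold_in /= !coprimezE; apply: coprime_dvdr.
Qed.

Fact plocal_subring (p : nat) : subring_closed (plocal p).
Proof.
split=> [|x y /plocalP[d pd [n xd]] /plocalP[e pe [m ye]]
         |x y /plocalP[d pd [n xd]] /plocalP[e pe [m ye]]].
- by apply/plocalP; exists 1; [rewrite coprimezE coprimen1 | exists 1].
- apply/plocalP; exists (d * e); first by rewrite coprimezMr pd.
  by exists (n * e - m * d); rewrite intrB !intrM -xd -ye; ring.
- apply/plocalP; exists (d * e); first by rewrite coprimezMr pd.
  by exists (n * m); rewrite !intrM -xd -ye; ring.
Qed.
HB.instance Definition _ (p : nat) :=
  GRing.isSubringClosed.Build rat (plocal p) (plocal_subring p).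

Lemma plocal_invn (p n : nat) : coprime p n -> n%:R^-1 \in plocal p.
Proof.
have [-> _ | n0 pn] := eqVneq n 0%N; first by rewrite invr0 rpred0.
apply/plocalP; exists n => //; exists 1.
by rewrite -[n%:~R]/(n%:R : rat) mulVf // pnatr_eq0.
Qed.

(** The form in which the congruence is proved: an equality of rationals whose
    error term is visibly p^e times a p-integral number. *)
Lemma rat_eqmod_plocal (p e : nat) (a b z : rat) :
  z \in plocal p -> a - b = p%:R ^+ e * z -> rat_eqmod p e a b.
Proof.
move=> zS E; have abS : a - b \in plocal p.
  by rewrite E rpredM // rpredX // rpred_nat.
split=> //; case/plocalP: zS => d pd [n zd].
have pe : coprimez (p ^ e)%N d by case: d pd {zd} => d; apply: coprimeXl.
rewrite -(Gauss_dvdzl _ pe).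
have -> : numq (a - b) * d = (p ^ e)%N%:Z * (n * denq (a - b)).
  apply: (@intr_inj rat); rewrite !intrM -zd numqE {1}E.
  by rewrite -pmulrn natrX; ring.
exact: dvdz_mulr.
Qed.

(** * Truncated products *)

(** Newton's identities express the elementary symmetric functions of degree
    at most 3 by power sums; the factor 6 clears their denominators.  The
    remainder has the form [X ^+ 4 * q] with q in the subring: adjoining a factor
    1 + X b only produces the new terms q (1 + X b) and b times the cubic
    coefficient. *)
Lemma prod_1DX_trunc (R : comNzRingType) (S : subringClosed R) (I : eqType)
    (r : seq I) (b : I -> R) (X : R) :
  X \in S -> {in r, forall i, b i \in S} ->
  let P m := \sum_(i <- r) b i ^+ m in
  exists2 q, q \in S &
    6 * \prod_(i <- r) (1 + X * b i) =
      6 + 6 * X * P 1%N + 3 * X ^+ 2 * (P 1%N ^+ 2 - P 2)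
      + X ^+ 3 * (P 1%N ^+ 3 - 3 * P 1%N * P 2 + 2 * P 3) + X ^+ 4 * q.
Proof.
move=> XS; elim: r => [|i r IH] bS /=.
  by exists 0; rewrite ?rpred0 // !big_nil; ring.
have bi : b i \in S by apply: bS; rewrite mem_head.
have br : {in r, forall j, b j \in S}.
  by move=> j jr; apply: bS; rewrite inE jr orbT.
have PS m : \sum_(j <- r) b j ^+ m \in S.
  by rewrite big_seq rpred_sum // => j /br bj; rewrite rpredX.
have [q qS E] := IH br; move: E (PS 1%N) (PS 2) (PS 3).
set P1 := \sum_(j <- r) b j ^+ 1; set P2 := \sum_(j <- r) b j ^+ 2.
set P3 := \sum_(j <- r) b j ^+ 3 => E S1 S2 S3.
exists (q * (1 + X * b i) + b i * (P1 ^+ 3 - 3 * P1 * P2 + 2 * P3)).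
  by rewrite !(rpred_nat, rpredB, rpredD, rpredM, rpredX, rpred1).
rewrite !big_cons -/P1 -/P2 -/P3 mulrCA E; ring.
Qed.

(** Comparing the two forms of the square modulo X^2 shows that X divides U1
    once 12 is inverted.  Hence U1^2, U1 U2 and U1^3 gain enough factors X to be
    absorbed in the remainder, and the expansion becomes linear in the power
    sums. *)
Lemma square_expansion_linearize (R : comNzRingType) (S : subringClosed R)
    (X c h U1 U2 U3 q : R) :
  GRing.lreg X -> X \in S -> c \in S -> h \in S -> 12 * h = 1 ->
  U1 \in S -> U2 \in S -> U3 \in S -> q \in S ->
  6 * (1 + X ^+ 2 * c) ^+ 2 =
    6 + 12 * X * U1 + 12 * X ^+ 2 * (U1 ^+ 2 - U2)
    + X ^+ 3 * (8 * U1 ^+ 3 - 24 * U1 * U2 + 16 * U3) + X ^+ 4 * q ->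
  exists2 z, z \in S &
    12 * X ^+ 2 * c = 12 * X * U1 - 12 * X ^+ 2 * U2 + 16 * X ^+ 3 * U3
                      + X ^+ 4 * z.
Proof.
move=> regX XS cS hS h12 S1 S2 S3 qS E.
pose w := 12 * c + 6 * X ^+ 2 * c ^+ 2 - 12 * (U1 ^+ 2 - U2)
          - X * (8 * U1 ^+ 3 - 24 * U1 * U2 + 16 * U3) - X ^+ 2 * q.
have wS : w \in S.
  by rewrite /w !(rpred_nat, rpredB, rpredD, rpredM, rpredX).
have Ew : 12 * U1 = X * w.
  (* The common summand completes each side to one of the two expressions
     for the square. *)
  apply: regX; apply: (addrI (6 + 12 * X ^+ 2 * (U1 ^+ 2 - U2)
    + X ^+ 3 * (8 * U1 ^+ 3 - 24 * U1 * U2 + 16 * U3) + X ^+ 4 * q)).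
  transitivity (6 * (1 + X ^+ 2 * c) ^+ 2); first by rewrite E; ring.
  by rewrite /w; ring.
have [v vS EU] : exists2 v, v \in S & U1 = X * v.
  exists (h * w); first exact: rpredM.
  by rewrite mulrCA -Ew mulrA [h * 12]mulrC h12 mul1r.
exists (12 * v ^+ 2 + 8 * X ^+ 2 * v ^+ 3 - 24 * v * U2 + q - 6 * c ^+ 2).
  by rewrite !(rpred_nat, rpredB, rpredD, rpredM, rpredX).
apply: (addrI (6 + 6 * X ^+ 4 * c ^+ 2)).
transitivity (6 * (1 + X ^+ 2 * c) ^+ 2); first by ring.
by rewrite E EU; ring.
Qed.

(** * Reflection of the power sums *)

Definition reflected_term (p k : nat) : rat := (k%:R * (p - k)%:R)^-1.

Definition reflected_sum (p m : nat) : rat :=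
  \sum_(1 <= k < p) reflected_term p k ^+ m.

Lemma double_inv_power_sum (p m : nat) :
  2 * inv_power_sum p m =
  \sum_(1 <= k < p) (k%:R^-1 ^+ m + (p - k)%:R^-1 ^+ m).
Proof.
rewrite big_split /= mulrDl mul1r /inv_power_sum.
congr (_ + _); last rewrite big_nat_rev /=; apply: eq_bigr => k _.
  by rewrite div1r exprVn.
by rewrite add1n subSS div1r exprVn.
Qed.

(** For a = 1/k and b = 1/(p-k) one has a b = u_k and a + b = p u_k, so each
    a^m + b^m is a polynomial in p and u_k: these are the identities writing
    power sums of two variables through their sum and product. *)
Lemma reflected_power_sum (p : nat) :
  let U := reflected_sum p in let H := inv_power_sum p in
  let P : rat := p%:R in
  [/\ 2 * H 1%N = P * U 1%N,
      2 * H 2 = P ^+ 2 * U 2 - 2 * U 1%N,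
      2 * H 3 = P ^+ 3 * U 3 - 3 * P * U 2 &
      2 * H 5 = P ^+ 5 * U 5 - 5 * P ^+ 3 * U 4 + 5 * P * U 3].
Proof.
have neq0 k : (1 <= k < p)%N ->
    [/\ k%:R != 0 :> rat, (p - k)%:R != 0 :> rat & p%:R = k%:R + (p - k)%:R :> rat].
  case/andP=> k0 kp; rewrite !pnatr_eq0 -natrD subnKC ?(ltnW kp) //.
  by rewrite -!lt0n subn_gt0.
split; rewrite double_inv_power_sum /reflected_sum !mulr_sumr
  -?sumrN -?big_split /=; apply: eq_big_nat => k /neq0[k0 pk0 ->];
  rewrite /reflected_term; field; exact/andP.
Qed.

(** * The binomial coefficient as a product *)

Lemma binomial_prod (p : nat) : (0 < p)%N ->
  'C(2 * p - 1, p - 1)%:R = \prod_(1 <= k < p) (1 + p%:R / k%:R) :> rat.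
Proof.
case: p => // n _.
have -> : (2 * n.+1 - 1 = n.+1 + n)%N by rewrite mulSn mul1n addnS subn1.
rewrite subn1 /=.
have f0 m : m`!%:R != 0 :> rat by rewrite pnatr_eq0 -lt0n fact_gt0.
have fE : ((n.+1 + n)`! = n.+1`! * \prod_(1 <= k < n.+1) (k + n.+1))%N.
  rewrite [LHS]fact_prod (@big_cat_nat _ _ _ n.+2) ?ltnS ?leq_addr //= -fact_prod.
  congr (_ * _)%N; have -> : (n.+1 + n).+1 = (n.+1 + n.+1)%N by rewrite addnS.
  by rewrite -[n.+2]add1n big_addn addnK.
have := bin_fact (leq_addl n.+1 n); rewrite addnK fE mulnA mulnC => /eqP.
rewrite eqn_pmul2l ?fact_gt0 // => /eqP E.
apply: (mulIf (f0 n)); rewrite -natrM E fact_prod !natr_prod -big_split /=.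
apply: eq_big_nat => k /andP[k0 _]; rewrite natrD mulrDl mul1r divfK //.
by rewrite pnatr_eq0 -lt0n.
Qed.

(** Reflecting one copy of the product pairs the factors at k and p - k; their
    product is 1 + p (1/k + 1/(p-k)) + p^2 u_k, and 1/k + 1/(p-k) = p u_k. *)
Lemma binomial_square_prod (p : nat) : (0 < p)%N ->
  'C(2 * p - 1, p - 1)%:R ^+ 2 =
    \prod_(1 <= k < p) (1 + p%:R ^+ 2 * (2 * reflected_term p k)) :> rat.
Proof.
move=> p0; rewrite expr2 binomial_prod // {2}big_nat_rev -big_split /=.
apply: eq_big_nat => k /andP[k0 kp]; rewrite add1n subSS /reflected_term.
have := subnKC (ltnW kp); have := kp; rewrite -subn_gt0.
move: (p - k)%N => j j0 <-; rewrite natrD.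
by field; rewrite !pnatr_eq0 -!lt0n j0 k0.
Qed.

(** * The congruence *)

(** For p = 2 and p = 3 the binomial coefficient is 3 and 10, which is not 1
    modulo 16 and 81. *)
Lemma wolstenholme_prime_gt3 (p : nat) : wolstenholme_prime p -> (3 < p)%N.
Proof.
by case=> pr; case: p pr => [|[|[|[|p]]]].
Qed.

Theorem proposition2 (p : nat) (hp : wolstenholme_prime p) :
  rat_eqmod p 8
    ('C(2 * p - 1, p - 1)%:R)
    (1 + 3 * p%:R / 2 * inv_power_sum p 1
       - p%:R ^+ 2 / 4 * inv_power_sum p 2
       + 7 * p%:R ^+ 3 / 12 * inv_power_sum p 3
       + 5 * p%:R ^+ 5 / 12 * inv_power_sum p 5).
Proof.
have p_gt3 := wolstenholme_prime_gt3 p hp; case: hp => pr hC.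
have p_gt0 : (0 < p)%N by rewrite prime_gt0.
have cop k : (0 < k < p)%N -> coprime p k.
  by case/andP=> k0 kp; rewrite prime_coprime // gtnNdvd.
have cop24 : coprime p 24.
  by rewrite -[24%N]/(2 ^ 3 * 3)%N coprimeMr coprimeXr ?cop // (ltn_trans _ p_gt3).
have cop12 : coprime p 12 by apply: coprime_dvdr cop24.
have pS : p%:R \in plocal p by rewrite rpred_nat.
have uS k : k \in index_iota 1 p -> reflected_term p k \in plocal p.
  rewrite mem_index_iota => /andP[k0 kp].
  rewrite /reflected_term -natrM plocal_invn // coprimeMr !cop ?k0 //.
  by rewrite subn_gt0 kp ltn_subrL k0 p_gt0.
have US m : reflected_sum p m \in plocal p.
  by rewrite /reflected_sum big_seq rpred_sum // => k /uS ku; rewrite rpredX.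
have [c EC] : exists c, 'C(2 * p - 1, p - 1) = (1 + p ^ 4 * c)%N.
  have C0 : (0 < 'C(2 * p - 1, p - 1))%N.
    by rewrite bin_gt0 leq_sub2r // leq_pmull.
  move/eqP: hC; rewrite eqn_mod_dvd // => /dvdnP[c Ec].
  by exists c; rewrite [(p ^ 4 * c)%N]mulnC -Ec subnKC.
have ECr : 'C(2 * p - 1, p - 1)%:R = 1 + (p%:R ^+ 2) ^+ 2 * c%:R :> rat.
  by rewrite EC natrD natrM natrX -exprM.
have [q qS Eq] := @prod_1DX_trunc _ (plocal p) _ (index_iota 1 p)
  (fun k => 2 * reflected_term p k) (p%:R ^+ 2) (rpredX 2 pS)
  (fun k ku => rpredM (rpred_nat _ 2) (uS k ku)).
have scale m : \sum_(1 <= k < p) (2 * reflected_term p k) ^+ m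
               = 2 ^+ m * reflected_sum p m.
  by rewrite mulr_sumr; apply: eq_bigr => k _; rewrite exprMn.
rewrite -binomial_square_prod // ECr !scale in Eq.
have [] := @square_expansion_linearize _ (plocal p) (p%:R ^+ 2) c%:R 12%:R^-1
  (reflected_sum p 1) (reflected_sum p 2) (reflected_sum p 3) q.
- by apply/mulfI; rewrite expf_neq0 // pnatr_eq0 -lt0n.
- exact: rpredX.
- exact: rpred_nat.
- exact: plocal_invn.
- by rewrite mulfV.
- exact: US.
- exact: US.
- exact: US.
- exact: qS.
- by rewrite Eq; ring.
move=> z zS Ez.
have [H1 H2 H3 H5] := reflected_power_sum p.
(* 2 z is twice the remainder of the linearized expansion; the terms in U_4
   and U_5 come from 2 H_5 alone. *)
apply: (@rat_eqmod_plocal _ _ _ _ (24%:R^-1 *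
  (2 * z + 25 * reflected_sum p 4 - 5 * p%:R ^+ 2 * reflected_sum p 5))).
  rewrite rpredM ?plocal_invn //.
  by rewrite !(rpred_nat, rpredB, rpredD, rpredM, rpredX).
have n24 : 24 != 0 :> rat by [].
apply: (mulfI n24); rewrite mulrBr.
have half (x y : rat) : 2 * x = y -> x = y / 2 by move=> <-; field.
have -> : 24 * ('C(2 * p - 1, p - 1)%:R : rat) =
  24 + 2 * (12 * (p%:R ^+ 2) ^+ 2 * c%:R) by rewrite ECr; ring.
rewrite Ez (half _ _ H1) (half _ _ H2) (half _ _ H3) (half _ _ H5).
by field.
Qed.
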